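(* Let $0<q<1$, let $\Gamma$ be an appropriate curve with interior $\mathcal D_-$ and exterior $\mathcal D_+$, let $w$ be an admissible function in $\mathcal D_-$, and let $P_n$ be the monic $n$th-degree orthogonal polynomial with respect to $w(x)\,d_qx$, i.e. $\int_{-1}^{1}P_n(x)P_m(x)w(x)\,d_qx=\gamma_n\delta_{n,m}$. Let $Y_n(z)$ be the solution $$Y_n(z)=\begin{bmatrix} P_n(z) & \displaystyle\oint_\Gamma \frac{P_n(s)w(s)h(s)}{2\pi i(z-s)}\,ds\\[2mm] \gamma_{n-1}^{-1}P_{n-1}(z) & \displaystyle\oint_\Gamma\frac{P_{n-1}(s)w(s)h(s)}{2\pi i(z-s)\gamma_{n-1}}\,ds\end{bmatrix},\qquad h(s)=\sum_{k=-\infty}^{\infty}\frac{2sq^k}{s^2-q^{2k}},$$ of the $q$-Riemann-Hilbert problem described in the context, and put $$\Psi_n(z)=Y_n(z)\begin{bmatrix}w(z)&0\\0&1\end{bmatrix}.$$ Then $$\Psi_{n+1}(z)=C_n(z)\Psi_n(z),\qquad C_n(z)=\begin{bmatrix} z+c_{n,1}&c_{n,2}\\ c_{n,3}&0\end{bmatrix},$$ (equivalently, $Y_{n+1}(z)=C_n(z)Y_n(z)$), where $c_{n,1}$, $c_{n,2}$ and $c_{n,3}$ are constants dependent on $n$.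
   Context: A positively oriented Jordan curve $\Gamma$ in $\mathbb C$ with interior $\mathcal D_-$ and exterior $\mathcal D_+$ is called appropriate if $\pm q^m\in\mathcal D_-$ for all integers $m\ge 0$ and $\pm q^m\in\mathcal D_+$ for all integers $m<0$. A function $w$ is called admissible if it is analytic in $\mathcal D_-$ and $w(z)\in\mathbb R$ for $z\in\mathbb R$. The Jackson integral is $\int_{-1}^{1}f(x)\,d_qx=(1-q)\sum_{k=0}^{\infty}\bigl(f(q^k)+f(-q^k)\bigr)q^k$. The $q$-Riemann-Hilbert problem asks for a $2\times2$ complex matrix function $Y(z)$ such that: (i) $Y$ is analytic on $\mathbb C\setminus\Gamma$; (ii) $Y$ has continuous boundary values $Y_-(s)$, $Y_+(s)$ as $z$ approaches $s\in\Gamma$ from $\mathcal D_-$, $\mathcal D_+$ respectively, with $Y_+(s)=Y_-(s)\begin{pmatrix}1&w(s)h(s)\\0&1\end{pmatrix}$ for $s\in\Gamma$; (iii) $Y(z)\begin{pmatrix}z^{-n}&0\\0&z^n\end{pmatrix}=I+O(1/|z|)$ as $|z|\to\infty$.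
   Formalization: As displayed, Y_n fails condition (iii): its (2,2) entry times z^n tends to 1/(1-q), not 1. The formal theorem keeps the displayed Y_n (n ≥ 1) and assumes only that it solves the problem after its second row is multiplied by some nonzero constant (1-q in the intended case). *)

(* Defs.v *)
(* MathComp and MathComp-Analysis; the complex numbers are R[i] over R : realType. *)
From HB Require Import structures.
From mathcomp Require Import all_boot all_order all_algebra.
From mathcomp Require Import all_classical all_reals all_analysis.
From mathcomp Require Import complex.

Set Implicit Arguments.
Unset Strict Implicit.
Unset Printing Implicit Defensive.

Import Order.TTheory GRing.Theory Num.Theory.
Import numFieldNormedType.Exports.

Local Open Scope classical_set_scope.
Local Open Scope ring_scope.

(* R[i] presented as a numClosedFieldType, so that the topology and the norm
   which MathComp-Analysis puts on every numFieldType are found on it.  The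
   norm takes values in R[i], whose order is partial: bounds are therefore
   quantified over R and embedded with toC. *)
Definition Cx (R : realType) : numClosedFieldType := (R[i])%C.

Definition toC (R : realType) (x : R) : Cx R := (x%:C)%C.

Definition expi (R : realType) (t : R) : Cx R := (cos t +i* sin t)%C.

Definition mx2 (K : pzRingType) (a b c d : K) : 'M[K]_2 :=
  \matrix_(i < 2, j < 2)
    if i == 0 then (if j == 0 then a else b) else (if j == 0 then c else d).

Section Curves.
Variable R : realType.
Implicit Types (gam : R -> Cx R) (f : Cx R -> Cx R) (z I : Cx R) (D : set (Cx R)).

Definition trace gam : set (Cx R) := gam @` `[0, 1].

Definition interior_of gam : set (Cx R) :=
  [set z | ~ trace gam z /\ bounded_set (connected_component (~` trace gam) z)].

Definition exterior_of gam : set (Cx R) :=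
  [set z | ~ trace gam z /\ ~ bounded_set (connected_component (~` trace gam) z)].

Definition jordan_curve gam : Prop :=
  [/\ {within `[0, 1], continuous gam},
      gam 0 = gam 1
    & forall s t, 0 <= s < 1 -> 0 <= t < 1 -> gam s = gam t -> s = t].

(* The winding number about z is 1: a continuous argument of gam - z increases
   by 2 pi.  No rectifiability is needed for this. *)
Definition winds_once gam z : Prop :=
  exists theta : R -> R,
    [/\ {within `[0, 1], continuous theta},
        forall t, 0 <= t <= 1 -> gam t - z = `|gam t - z| * expi (theta t)
      & theta 1 - theta 0 = 2 * pi].

Definition positively_oriented gam : Prop :=
  forall z, interior_of gam z -> winds_once gam z.

(* The contour integral of f along gam exists and equals I, as a limit of
   Riemann-Stieltjes sums over tagged subdivisions 0 = t_0 <= ... <= t_m = 1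
   with tags x_i in [t_i, t_(i+1)]. *)
Definition is_contour_integral gam f I : Prop :=
  forall e : R, 0 < e -> exists2 d : R, 0 < d &
  forall (m : nat) (t x : nat -> R),
    t 0%N = 0 -> t m = 1 ->
    (forall i, (i < m)%N -> t i <= x i <= t i.+1 /\ t i.+1 - t i < d) ->
    `| \sum_(i < m) f (gam (x i)) * (gam (t i.+1) - gam (t i)) - I | < toC e.

(* Meant for D open: derivable along 1 over the scalar field Cx R is complex
   differentiability. *)
Definition analytic_on D f : Prop := forall z, D z -> derivable f z 1.

End Curves.

Section QOrthogonal.
Variable R : realType.
Implicit Types (q : R) (gam : R -> Cx R) (w f : Cx R -> Cx R) (z l : Cx R).
Implicit Types (P : nat -> {poly Cx R}) (gamma : nat -> Cx R).
Implicit Types (Y : Cx R -> 'M[Cx R]_2).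

Definition appropriate q gam : Prop :=
  [/\ jordan_curve gam,
      positively_oriented gam,
      forall m : int, 0 <= m ->
        interior_of gam (toC (q ^ m)) /\ interior_of gam (- toC (q ^ m))
    & forall m : int, m < 0 ->
        exterior_of gam (toC (q ^ m)) /\ exterior_of gam (- toC (q ^ m))].

(* w is a total function; only its values in the interior are constrained. *)
Definition admissible gam w : Prop :=
  analytic_on (interior_of gam) w /\
  (forall x : R, interior_of gam (toC x) -> w (toC x) \is Num.real).

(* The Jackson integral of f over [-1, 1] converges to l. *)
Definition is_jackson q f l : Prop :=
  series (fun k => toC (1 - q) *
    ((f (toC (q ^+ k)) + f (- toC (q ^+ k))) * toC (q ^+ k))) @ \oo --> l.

Definition monic_orthogonal q w P gamma : Prop :=
  [/\ forall n, P n \is monic /\ size (P n) = n.+1,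
      forall n m, is_jackson q (fun x => (P n).[x] * (P m).[x] * w x)
                    (if n == m then gamma n else 0)
    & forall n, gamma n != 0].

Definition h_term q z (k : int) : Cx R :=
  2 * z * toC (q ^ k) / (z ^+ 2 - toC (q ^ (2 * k))).

(* The bilateral series is split into k >= 0 and k < 0. *)
Definition h_q q z : Cx R :=
  limn (series (fun k : nat => h_term q z k%:Z)) +
  limn (series (fun k : nat => h_term q z (- k.+1%:Z))).

Definition cauchy_kernel q w (p : {poly Cx R}) z : Cx R -> Cx R :=
  fun s => p.[s] * w s * h_q q s / (toC (2 * pi) * 'i * (z - s)).

(* The explicit matrix Y_n off the curve, for n >= 1. *)
Definition is_Yn q gam w P gamma (n : nat) Y : Prop :=
  forall z, ~ trace gam z ->
  exists I1 I2 : Cx R,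
    [/\ is_contour_integral gam (cauchy_kernel q w (P n) z) I1,
        is_contour_integral gam
          (fun s => cauchy_kernel q w (P n.-1) z s / gamma n.-1) I2
      & Y z = mx2 (P n).[z]                        I1
                  ((gamma n.-1)^-1 * (P n.-1).[z]) I2].

Definition qRHP q gam w (n : nat) Y : Prop :=
  [/\
      (forall i j, analytic_on (~` trace gam) (fun z => Y z i j)),
      (exists Ym Yp : Cx R -> 'M[Cx R]_2,
        [/\ {within trace gam, continuous Ym},
            {within trace gam, continuous Yp}
          & forall s : Cx R, trace gam s ->
            [/\ Y z @[z --> within (interior_of gam) (nbhs s)] --> Ym s,
                Y z @[z --> within (exterior_of gam) (nbhs s)] --> Yp s
              & Yp s = Ym s *m mx2 1 (w s * h_q q s) 0 1]])
    & (exists K M : R, 0 < M /\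
        forall z i j, toC M < `|z| ->
          `|(Y z *m mx2 (z ^- n) 0 0 (z ^+ n) - 1%:M) i j| <= toC K / `|z|)].

(* Y solves the problem up to a scalar factor kappa on its second row.
   kappa = 1 is the problem itself.  The residue of h at +-q^k is q^k, so the
   contour integral of P_(n-1)(s) s^(n-1) w(s) h(s) is 2 pi i times the Jackson
   sum without its prefactor 1 - q, that is 2 pi i gamma_(n-1) / (1 - q), and
   the matrix of is_Yn meets the normalisation at infinity with
   kappa = 1 - q. *)
Definition qRHP_up_to (kappa : Cx R) q gam w n Y : Prop :=
  qRHP q gam w n (fun z => mx2 1 0 0 kappa *m Y z).

Definition Psi w Y z : 'M[Cx R]_2 := Y z *m mx2 (w z) 0 0 1.

End QOrthogonal.

(* Main.v *)
(* The first column is the three-term recurrence P_(n+1) = (z + a) P_n + b P_(n-1)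
   together with P_n / gamma_n = gamma_n^-1 P_n.  In the (1,2) entry, writing
   s = z - (z - s) turns the recurrence into one for the Cauchy transforms, up to
   the defect - (1 / 2 pi i) \oint P_n w h ds.  This defect does not depend on z,
   and for n >= 1 the normalisation of Y_n and Y_(n+1) at infinity makes it
   O(1/|z|); the points q^-m of the exterior tend to infinity, so it vanishes. *)
Require Import Defs.
From HB Require Import structures.
From mathcomp Require Import all_boot all_order all_algebra.
From mathcomp Require Import all_classical all_reals all_analysis.
From mathcomp Require Import complex ring.
Set Implicit Arguments.
Unset Strict Implicit.
Unset Printing Implicit Defensive.
Import Order.TTheory GRing.Theory Num.Theory.
Import numFieldNormedType.Exports.
Local Open Scope classical_set_scope.
Local Open Scope ring_scope.

(** * Comparison of complex norms with reals *)

Section ComplexBounds.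
Variable R : realType.
Implicit Types x z : Cx R.

(** Norms live in [R[i]], whose order is partial; the representative [r] brings comparisons back to
    the total order of [R]. *)
Lemma norm_toC x : exists2 r : R, 0 <= r & `|x| = toC r.
Proof. by case: x => a b; exists (Num.sqrt (a ^+ 2 + b ^+ 2)); rewrite ?sqrtr_ge0. Qed.

Lemma ltr_toC (a b : R) : (toC a < toC b) = (a < b).
Proof. exact: ltcR. Qed.

Lemma ler_toC (a b : R) : (toC a <= toC b) = (a <= b).
Proof. exact: lecR. Qed.

Lemma norm_lt_toC_eq0 x : (forall e : R, 0 < e -> `|x| < toC e) -> x = 0.
Proof.
move=> xe; have [r r0 xr] := norm_toC x.
have [r_gt0|r_le0] := ltP 0 r; first by have := xe r r_gt0; rewrite xr ltxx.
apply/normr0_eq0; rewrite xr; congr toC.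
by apply/eqP; rewrite eq_le r0 r_le0.
Qed.

(** Provides exterior points of an appropriate curve arbitrarily far from the origin. *)
Lemma expr_inv_unbounded (q B : R) : 0 < q < 1 -> exists n, B < (q ^+ n.+1)^-1.
Proof.
case/andP=> q0 q1.
have [B0|B0] := leP B 0.
  by exists 0%N; apply: le_lt_trans B0 _; rewrite invr_gt0 exprn_gt0.
have /cvgrPdist_lt/(_ B^-1) : (fun n => q ^+ n) @ \oo --> (0 : R).
  by apply: cvg_expr; rewrite ger0_norm // ltW.
rewrite invr_gt0 => /(_ B0) [N _ /(_ N.+1)] /=.
rewrite leqnSn sub0r normrN ger0_norm ?exprn_ge0 ?(ltW q0) // => /(_ isT) h.
by exists N; rewrite -[B]invrK ltf_pV2 ?posrE ?invr_gt0 ?exprn_gt0.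
Qed.

End ComplexBounds.

(** * Linearity and uniqueness of the Riemann-Stieltjes contour integral *)

Section ContourIntegral.
Variables (R : realType) (gam : R -> Cx R).
Implicit Types (f g : Cx R -> Cx R) (I J a : Cx R).

(** The bound 0 propagates upwards from [t 0], the bound 1 downwards from [t m]. *)
Lemma subdivision_tag_itv01 (m : nat) (t x : nat -> R) :
  t 0%N = 0 -> t m = 1 -> (forall i, (i < m)%N -> t i <= x i <= t i.+1) ->
  forall i, (i < m)%N -> 0 <= x i <= 1.
Proof.
move=> t0 tm tx.
have tS i : (i < m)%N -> t i <= t i.+1.
  by move=> /tx /andP[h1 h2]; exact: le_trans h1 h2.
have tge0 i : (i <= m)%N -> 0 <= t i.
  elim: i => [|i IH] im; first by rewrite t0.
  by apply: le_trans (IH (ltnW im)) (tS _ im).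
have tle1 i : (i <= m)%N -> t (m - i)%N <= 1.
  elim: i => [|i IH] im; first by rewrite subn0 tm.
  apply: le_trans (IH (ltnW im)).
  have -> : (m - i = (m - i.+1).+1)%N by rewrite -subSn // subSS.
  by apply: tS; rewrite ltn_subrL /=; exact: leq_ltn_trans im.
move=> i im; have /andP[h1 h2] := tx i im.
rewrite (le_trans (tge0 i (ltnW im)) h1) (le_trans h2) //.
by have := tle1 (m - i.+1)%N (leq_subr _ _); rewrite subKn.
Qed.

(** All tags lie in [0, 1], so the sums see the integrand on the curve only. Integrands may thus be
    simplified under the assumption that [s] is on the curve, where z - s is nonzero for z off
    it. *)
Lemma eq_contour_integral f g I : (forall s, trace gam s -> f s = g s) ->
  is_contour_integral gam f I -> is_contour_integral gam g I.
Proof.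
move=> fg fI e e0; have [d d0 H] := fI e e0; exists d => // m t x t0 tm tx.
have := H m t x t0 tm tx; congr (`|_ - _| < _).
apply: eq_bigr => i _; rewrite fg //; exists (x i) => //=; rewrite in_itv /=.
by apply: (@subdivision_tag_itv01 m t x) => // j /tx[].
Qed.

Lemma contour_integralD f g I J :
  is_contour_integral gam f I -> is_contour_integral gam g J ->
  is_contour_integral gam (fun s => f s + g s) (I + J).
Proof.
move=> fI gJ e e0; have e20 : 0 < e / 2 by rewrite divr_gt0.
have [d1 d10 H1] := fI _ e20; have [d2 d20 H2] := gJ _ e20.
exists (Num.min d1 d2); first by rewrite lt_min d10.
move=> m t x t0 tm tx.
have {}H1 : _ := H1 m t x t0 tm _; have {}H2 : _ := H2 m t x t0 tm _.
under eq_bigr do rewrite mulrDl.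
rewrite big_split /= opprD addrACA (le_lt_trans (ler_normD _ _)) //.
have -> : toC e = toC (e / 2) + toC (e / 2).
  by rewrite [e in LHS]splitr /toC rmorphD.
by apply: ltrD; [apply: H1|apply: H2] => i /tx[-> +]; rewrite lt_min => /andP[].
Qed.

Lemma contour_integralZ f I a : is_contour_integral gam f I ->
  is_contour_integral gam (fun s => a * f s) (a * I).
Proof.
move=> fI e e0; have [r r0 ar] := norm_toC a.
(* Dividing by [r + 1] instead of [r] covers the case a = 0. *)
have r1 : 0 < r + 1 by rewrite ltr_wpDl.
have [d d0 H] := fI (e / (r + 1)) (divr_gt0 e0 r1).
exists d => // m t x t0 tm tx; have {}H := H m t x t0 tm tx.
under eq_bigr do rewrite -mulrA.
rewrite -mulr_sumr -mulrBr normrM ar.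
have [s s0 E] := norm_toC (\sum_(i < m) f (gam (x i)) * (gam (t i.+1) - gam (t i)) - I).
rewrite E in H *; rewrite ltr_toC ltr_pdivlMr // in H.
have -> : toC r * toC s = toC (r * s) by rewrite /toC rmorphM.
rewrite ltr_toC; apply: le_lt_trans H.
by rewrite mulrC ler_wpM2l // lerDl.
Qed.

Lemma contour_integral_unique f I J :
  is_contour_integral gam f I -> is_contour_integral gam f J -> I = J.
Proof.
move=> fI fJ; apply/eqP; rewrite -subr_eq0; apply/eqP/norm_lt_toC_eq0 => e e0.
have e20 : 0 < e / 2 by rewrite divr_gt0.
have [d1 d10 H1] := fI _ e20; have [d2 d20 H2] := fJ _ e20.
have d0 : 0 < Num.min d1 d2 by rewrite lt_min d10.
have [m] : exists m : nat, (Num.min d1 d2)^-1 < m.+1%:R.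
  by exists (Num.truncn (Num.min d1 d2)^-1); apply: truncnS_gt.
move=> md.
(* The uniform subdivision, tagged at left endpoints, has mesh below both thresholds; its single sum
   is within e/2 of [I] and of [J]. *)
pose t (i : nat) : R := i%:R / m.+1%:R.
have ht i : t i <= t i <= t i.+1 /\ t i.+1 - t i < Num.min d1 d2.
  have m0 : 0 < m.+1%:R :> R by rewrite ltr0n.
  split; first by rewrite lexx /t ler_pM2r ?invr_gt0 // ler_nat leqnSn.
  by rewrite /t -mulrBl -natrB // subSnn mul1r invf_plt // posrE.
have t0 : t 0%N = 0 by rewrite /t mul0r.
have tm : t m.+1 = 1 by rewrite /t divff // pnatr_eq0.
have {}H1 : _ := H1 m.+1 t t t0 tm _; have {}H2 : _ := H2 m.+1 t t t0 tm _.
set S := \sum_(i < _) _ in H1 H2.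
have -> : I - J = (S - J) - (S - I) by ring.
rewrite (le_lt_trans (ler_normB _ _)) //.
have -> : toC e = toC (e / 2) + toC (e / 2).
  by rewrite [e in LHS]splitr /toC rmorphD.
apply: ltrD; [apply: H2|apply: H1] => i _; have [-> +] := ht i;
  by rewrite lt_min => /andP[].
Qed.

End ContourIntegral.

(** * The three-term recurrence from Jackson orthogonality *)

Section Recurrence.
Variables (R : realType) (q : R) (w : Cx R -> Cx R).
Implicit Types (f g : Cx R -> Cx R) (p r : {poly Cx R}) (a l : Cx R).

Lemma is_jacksonD f g l l' : is_jackson q f l -> is_jackson q g l' ->
  is_jackson q (fun x => f x + g x) (l + l').
Proof.
move=> fl gl; rewrite /is_jackson.
set u := series _; suff -> : u = series (fun k => toC (1 - q) *
    ((f (toC (q ^+ k)) + f (- toC (q ^+ k))) * toC (q ^+ k))) \+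
  series (fun k => toC (1 - q) *
    ((g (toC (q ^+ k)) + g (- toC (q ^+ k))) * toC (q ^+ k))) by exact: cvgD fl gl.
apply/funext => n; rewrite /u /series /= -big_split /=.
by apply: eq_bigr => k _; ring.
Qed.

Lemma is_jacksonZ f l a : is_jackson q f l ->
  is_jackson q (fun x => a * f x) (a * l).
Proof.
move=> fl; rewrite /is_jackson.
set u := series _; suff -> : u = (fun n => a * series (fun k => toC (1 - q) *
    ((f (toC (q ^+ k)) + f (- toC (q ^+ k))) * toC (q ^+ k))) n).
  by apply: cvgM fl; exact: cvg_cst.
apply/funext => n; rewrite /u /series /= mulr_sumr.
by apply: eq_bigr => k _; ring.
Qed.

Lemma is_jackson_unique f l l' : is_jackson q f l -> is_jackson q f l' -> l = l'.
Proof. by move=> fl fl'; apply: (cvg_unique _ fl fl'). Qed.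

Lemma is_jackson_sum (n : nat) (F : nat -> Cx R -> Cx R) (l a : nat -> Cx R) :
  (forall i, is_jackson q (F i) (l i)) ->
  is_jackson q (fun x => \sum_(i < n) a i * F i x) (\sum_(i < n) a i * l i).
Proof.
move=> H; elim: n => [|n IH].
  rewrite big_ord0 /is_jackson; set u := series _.
  suff -> : u = fun=> 0 by exact: cvg_cst.
  apply/funext => k; rewrite /u /series /= big1 // => j _.
  by rewrite !big_ord0 addr0 mul0r mulr0.
rewrite big_ord_recr /=.
have := is_jacksonD IH (is_jacksonZ (a := a n) (H n)).
by congr is_jackson; apply/funext => x; rewrite big_ord_recr.
Qed.

Lemma monic_coef p n : p \is monic -> size p = n.+1 -> p`_n = 1.
Proof. by move=> /monicP p1 sp; rewrite -p1 lead_coefE sp. Qed.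

Lemma monic_family_expansion (P : nat -> {poly Cx R}) :
  (forall n, P n \is monic /\ size (P n) = n.+1) ->
  forall n p, (size p <= n)%N ->
  exists a : nat -> Cx R, p = \sum_(i < n) a i *: P i.
Proof.
move=> hP; elim=> [|n IH] p sp.
  by exists (fun=> 0); rewrite big_ord0; apply/eqP; rewrite -size_poly_leq0.
have [Pm Ps] := hP n.
have [|b pb] := IH (p - p`_n *: P n).
  apply/leq_sizeP => j; rewrite leq_eqVlt => /predU1P[<-|nj].
    by rewrite coefB coefZ (monic_coef Pm Ps) mulr1 subrr.
  rewrite coefB coefZ (nth_default _ (leq_trans sp nj)).
  by rewrite (@nth_default _ _ (P n)) ?Ps // mulr0 subrr.
exists (fun i => if i == n then p`_n else b i).
rewrite big_ord_recr /= eqxx -[LHS](subrK (p`_n *: P n)) pb.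
by congr (_ + _); apply: eq_bigr => i _; rewrite ltn_eqF.
Qed.

(** The leading terms of P_(n+2) and X P_(n+1) cancel, so their difference expands in P_0, ...,
    P_(n+1). Pairing it with P_m for m < n gives a_m gamma_m = 0, hence a_m = 0, and only the
    indices n and n+1 survive. *)
Lemma three_term_recurrence (P : nat -> {poly Cx R}) (gamma : nat -> Cx R) :
  monic_orthogonal q w P gamma -> forall n, exists a b,
    P n.+2 = ('X + a%:P) * P n.+1 + b *: P n.
Proof.
case=> hP orth gam0 n.
have orth0 m p : (size p <= m)%N ->
    is_jackson q (fun x => (P m).[x] * p.[x] * w x) 0.
  move=> /(monic_family_expansion hP)[a ->].
  have := is_jackson_sum (n := m) (a := a) (fun i => orth m i).
  rewrite big1 => [|i _]; last by rewrite gtn_eqF // mulr0.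
  congr is_jackson; apply/funext => x; rewrite horner_sum mulr_sumr mulr_suml.
  by apply: eq_bigr => i _; rewrite hornerZ; ring.
have [Pm1 Ps1] := hP n.+1; have [Pm2 Ps2] := hP n.+2.
have [|a pa] := @monic_family_expansion P hP n.+2 (P n.+2 - 'X * P n.+1).
  have s3 : size ('X * P n.+1) = n.+3.
    by rewrite mulrC size_mulX ?Ps1 // -size_poly_gt0 Ps1.
  apply/leq_sizeP => j; rewrite leq_eqVlt => /predU1P[<-|nj].
    by rewrite coefB coefXM /= (monic_coef Pm1 Ps1) (monic_coef Pm2 Ps2) subrr.
  by rewrite coefB (@nth_default _ _ (P n.+2)) ?Ps2 // nth_default ?s3 // subrr.
have a0 m : (m < n)%N -> a m = 0.
  move=> mn; have Ps m' : size (P m') = m'.+1 by case: (hP m').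
  have h1 := orth0 n.+2 (P m) ltac:(by rewrite Ps ltnS ltnW // ltnS ltnW).
  (* The pairing is bilinear, without conjugation, so X moves from P_(n+1) onto P_m; X P_m has
     degree m+1 < n+1. *)
  have h2 : is_jackson q (fun x => (P n.+1).[x] * ('X * P m).[x] * w x) 0.
    by apply: orth0; rewrite mulrC size_mulX ?Ps // -size_poly_gt0 Ps.
  have h3 := is_jackson_sum (n := n.+2) (a := a) (fun i => orth i m).
  have h4 := is_jacksonD h1 (is_jacksonZ (a := -1) h2).
  have : is_jackson q
      (fun x => \sum_(i < n.+2) a i * ((P i).[x] * (P m).[x] * w x)) (0 + -1 * 0).
    move: h4; congr is_jackson; apply/funext => x.
    transitivity ((P n.+2 - 'X * P n.+1).[x] * (P m).[x] * w x).
      by rewrite hornerD hornerN !hornerM hornerX; ring.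
    rewrite pa horner_sum !mulr_suml.
    by apply: eq_bigr => i _; rewrite hornerZ; ring.
  move=> /(is_jackson_unique h3).
  have mn2 : (m < n.+2)%N by rewrite ltnS ltnW // ltnS ltnW.
  rewrite (bigD1 (Ordinal mn2)) //= eqxx big1 => [|i im].
    rewrite addr0 mulr0 addr0 => /eqP; rewrite mulf_eq0 (negbTE (gam0 m)) orbF.
    by move/eqP.
  case: eqP => [E|_]; last by rewrite mulr0.
  by move: im; rewrite -val_eqE /= E eqxx.
exists (a n.+1), (a n).
rewrite -[LHS](subrK ('X * P n.+1)) pa !big_ord_recr /= big1 => [|i _].
  by rewrite mulrDl mul_polyC add0r; ring.
by rewrite a0 ?scale0r.
Qed.

End Recurrence.

(** * Decay of the second column at infinity *)

Section Asymptotics.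
Variable R : realType.

Lemma mulmx_mx2 (K : pzRingType) (a b c d a' b' c' d' : K) :
  mx2 a b c d *m mx2 a' b' c' d' =
  mx2 (a * a' + b * c') (a * b' + b * d') (c * a' + d * c') (c * b' + d * d').
Proof.
apply/matrixP => i j; rewrite !mxE !big_ord_recl big_ord0 addr0 !mxE /=.
by case: i => -[|[|//]] ?; case: j => -[|[|//]] ?.
Qed.

Lemma qRHP_second_column_decay (kappa : Cx R) (q : R) gam w n (Y : Cx R -> 'M[Cx R]_2) :
  kappa != 0 -> qRHP_up_to kappa q gam w n.+1 Y ->
  exists K M : Cx R, [/\ 0 <= K, 0 <= M & forall z, M < `|z| ->
    `|z ^+ 2 * Y z 0 1| <= K /\ `|z * Y z 1 1| <= K].
Proof.
move=> k0 [_ _ [K [M [M0 H]]]].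
pose L := `|toC K|; have L0 : 0 <= L by exact: normr_ge0.
have Lk : 0 <= (L + 1) / `|kappa| by rewrite divr_ge0 // addr_ge0.
have M0' : 0 <= toC M by rewrite -[0]/(toC 0) ler_toC ltW.
(* [L] bounds the (1,2) entry. For the (2,2) entry, [L + 1] absorbs the 1 of the identity matrix and
   the division undoes the row scaling. The 1 added to [toC M] forces |z| >= 1. *)
exists (L + (L + 1) / `|kappa|), (toC M + 1).
split; rewrite ?addr_ge0 // => z zM.
have zM1 : toC M < `|z| by rewrite (le_lt_trans _ zM) // lerDl.
have z1 : 1 <= `|z| by rewrite (le_trans _ (ltW zM)) // lerDr.
have z0 : 0 < `|z| by rewrite (lt_le_trans _ z1).
have KL : toC K <= L.
  by apply/real_ler_norm/complex_realP; exists K.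
have h01 := H z 0 1 zM1; have h11 := H z 1 1 zM1.
rewrite !mxE !big_ord_recl !big_ord0 !mxE /= !big_ord_recl !big_ord0 !mxE /= in h01 h11.
have E01 : lift ord0 ord0 = 1 :> 'I_2 by apply/val_inj.
rewrite E01 in h01 h11.
split.
  apply: (@le_trans _ _ L); last by rewrite lerDl.
  apply: le_trans KL; move: h01; rewrite ler_pdivlMr //; apply: le_trans.
  rewrite -normrM; set u := (X in _ <= `|X|).
  have -> : u = (z ^+ 2 * Y z 0 1) * z ^+ n by rewrite /u !exprS; ring.
  by rewrite [leRHS]normrM ler_peMr // normrX exprn_ege1.
apply: (@le_trans _ _ ((L + 1) / `|kappa|)); last by rewrite lerDr.
rewrite ler_pdivlMr ?normr_gt0 // -normrM.
move: h11; set u := (X in `|X| <= _ -> _).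
have -> : u = kappa * Y z 1 1 * z ^+ n.+1 - 1 by rewrite /u; ring.
move=> h.
have h' : `|kappa * Y z 1 1 * z ^+ n.+1 - 1| <= L.
  apply: le_trans h _; rewrite ler_pdivrMr //; apply: (le_trans KL).
  by rewrite ler_peMr.
apply: (@le_trans _ _ `|kappa * Y z 1 1 * z ^+ n.+1|); last first.
  rewrite -[X in `|X|](subrK 1); apply: le_trans (ler_normD _ _) _.
  by rewrite normr1 lerD2r.
rewrite (_ : z * _ * _ = (kappa * Y z 1 1) * z); last by ring.
by rewrite normrM [leRHS]normrM ler_wpM2l // normrX exprS ler_peMr // exprn_ege1.
Qed.

End Asymptotics.

(** * The defect of the recurrence for the Cauchy transforms *)

Section Defect.
Variables (R : realType) (q : R) (gam : R -> Cx R) (w : Cx R -> Cx R).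
Variables (P : nat -> {poly Cx R}) (gamma : nat -> Cx R).
Variable Y : nat -> Cx R -> 'M[Cx R]_2.

(* The integrand of the defect is - P_n w h / (2 pi i), in which z no longer occurs. *)
Lemma first_row_defect_constant (a b : nat -> Cx R) (k : nat) :
  (forall n, gamma n != 0) ->
  (forall n, P n.+2 = ('X + (a n)%:P) * P n.+1 + b n *: P n) ->
  (forall n, (0 < n)%N -> is_Yn q gam w P gamma n (Y n)) ->
  exists D, forall z, ~ trace gam z ->
    Y k.+2 z 0 1 - (z + a k) * Y k.+1 z 0 1 - b k * gamma k * Y k.+1 z 1 1 = D.
Proof.
move=> gam0 hrec hY.
pose F s := - ((P k.+1).[s] * w s * h_q q s / (toC (2 * pi) * 'i)).
have hF z : ~ trace gam z -> is_contour_integral gam F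
    (Y k.+2 z 0 1 - (z + a k) * Y k.+1 z 0 1 - b k * gamma k * Y k.+1 z 1 1).
  move=> hz.
  have [I1 [I2 [I1P I2P ->]]] := hY k.+1 isT z hz.
  have [J1 [J2 [J1P J2P ->]]] := hY k.+2 isT z hz.
  rewrite !mxE /=; set T := (X in is_contour_integral _ _ X).
  (* The factor [gamma k] cancels the normalisation by 1 / gamma_k of the second-row integral. *)
  have -> : T = J1 + - (z + a k) * I1 + - (b k * gamma k) * I2 by rewrite /T; ring.
  have := contour_integralD (contour_integralD J1P (contour_integralZ (- (z + a k)) I1P))
    (contour_integralZ (- (b k * gamma k)) I2P).
  apply: eq_contour_integral => s hs.
  have zs : z - s != 0 by rewrite subr_eq0; apply/eqP => zs; apply: hz; rewrite zs.
  have pi0 : toC (2 * pi) != 0 :> Cx R.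
    rewrite -[0]/(toC 0); apply/eqP => /complexI /eqP.
    by rewrite mulf_eq0 pnatr_eq0 /= gt_eqF // pi_gt0.
  rewrite /F /cauchy_kernel /= hrec !hornerE /=.
  have := mulf_neq0 pi0 (neq0Ci (Cx R)); move: (_ * 'i) => d d0.
  by field; rewrite gam0 zs d0.
(* [D] is the defect at any one point off the curve: at every other such point the defect is an
   integral of the same [F]. *)
have [[z0 hz0]|none] := pselect (exists z, ~ trace gam z); last first.
  by exists 0 => z hz; case: none; exists z.
by eexists => z hz; exact: contour_integral_unique (hF z hz) (hF z0 hz0).
Qed.

(** The column decay bounds u D by a fixed [B] at far points [u] off the curve, while |u D| is
    unbounded if D is nonzero. *)
Lemma constant_defect_eq0 (kappa a c : Cx R) (k : nat) :
  0 < q < 1 -> appropriate q gam -> kappa != 0 ->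
  qRHP_up_to kappa q gam w k.+1 (Y k.+1) ->
  qRHP_up_to kappa q gam w k.+2 (Y k.+2) ->
  (exists D, forall z, ~ trace gam z ->
    Y k.+2 z 0 1 - (z + a) * Y k.+1 z 0 1 - c * Y k.+1 z 1 1 = D) ->
  forall z, ~ trace gam z ->
    Y k.+2 z 0 1 - (z + a) * Y k.+1 z 0 1 - c * Y k.+1 z 1 1 = 0.
Proof.
move=> hq [_ _ _ hext] k0 H1 H2 [D HD] z /HD ->.
have [K1 [M1 [K10 M10 B1]]] := qRHP_second_column_decay k0 H1.
have [K2 [M2 [K20 M20 B2]]] := qRHP_second_column_decay k0 H2.
pose B := K2 + (K1 + `|a| * K1) + `|c| * K1.
have B0 : 0 <= B by rewrite !addr_ge0 // mulr_ge0.
apply/eqP/negPn/negP => D0.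
have nD0 : 0 < `|D| by rewrite normr_gt0.
(* This sum dominates each requirement on |u| at once: |u| >= 1, both decay thresholds, and |u D| >
   B. *)
have T0 : 0 <= 1 + M1 + M2 + B / `|D| by rewrite !addr_ge0 // divr_ge0.
have [T _ TE] := norm_toC (1 + M1 + M2 + B / `|D|); rewrite ger0_norm // in TE.
have [n Tn] := expr_inv_unbounded T hq.
pose u := toC (q ^ (- n.+1%:Z)).
have nu : `|u| = toC (q ^+ n.+1)^-1.
  rewrite /u -exprnN; apply: ger0_norm; rewrite -[0]/(toC 0) ler_toC.
  by case/andP: hq => q0 _; rewrite invr_ge0 exprn_ge0 // ltW.
have uT : 1 + M1 + M2 + B / `|D| < `|u| by rewrite TE nu ltr_toC.
have hu : ~ trace gam u by have [[]] := hext (- n.+1%:Z) isT.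
have BD0 : 0 <= B / `|D| by rewrite divr_ge0.
have u1 : 1 <= `|u|.
  by rewrite (le_trans _ (ltW uT)) // -!addrA lerDl !addr_ge0.
have M1u : M1 < `|u|.
  by apply: le_lt_trans uT; rewrite [1 + M1]addrC -!addrA lerDl !addr_ge0.
have M2u : M2 < `|u|.
  by apply: le_lt_trans uT; rewrite [1 + M1 + M2]addrC -!addrA lerDl !addr_ge0.
have uDB : B < `|u * D|.
  rewrite normrM -ltr_pdivrMr //.
  by apply: le_lt_trans uT; rewrite lerDr !addr_ge0.
have lower (x K : Cx R) : `|u ^+ 2 * x| <= K -> `|u * x| <= K.
  apply: le_trans; rewrite expr2 -mulrA [leRHS]normrM.
  by rewrite ler_peMl.
have [b1 b1'] := B1 u M1u; have [b2 _] := B2 u M2u.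
have : `|u * D| <= B.
  (* The factor u + a costs one power of u, which the quadratic decay of the (1,2) entry of [Y k.+1]
     pays for. *)
  rewrite -(HD u hu).
  have -> : u * (Y k.+2 u 0 1 - (u + a) * Y k.+1 u 0 1 - c * Y k.+1 u 1 1) =
    u * Y k.+2 u 0 1 - (u ^+ 2 * Y k.+1 u 0 1 + a * (u * Y k.+1 u 0 1))
    - c * (u * Y k.+1 u 1 1) by ring.
  rewrite (le_trans (ler_normB _ _)) // lerD //; last by rewrite normrM ler_wpM2l.
  rewrite (le_trans (ler_normB _ _)) // lerD //; first exact: lower.
  rewrite (le_trans (ler_normD _ _)) // lerD // normrM ler_wpM2l //.
  exact: lower.
by move=> /(lt_le_trans uDB); rewrite ltxx.
Qed.

End Defect.

(** * Entrywise verification of the transfer matrix *)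

Unset Implicit Arguments.

Theorem corollary2p1 (R : realType) (q : R) (gam : R -> Cx R)
    (w : Cx R -> Cx R) (P : nat -> {poly Cx R}) (gamma : nat -> Cx R)
    (Y : nat -> Cx R -> 'M[Cx R]_2) (kappa : Cx R)
    (hq : 0 < q < 1)
    (hgam : appropriate q gam)
    (hw : admissible gam w)
    (hP : monic_orthogonal q w P gamma)
    (hY : forall n, (0 < n)%N -> is_Yn q gam w P gamma n (Y n))
    (hkappa : kappa != 0)
    (hRHP : forall n, (0 < n)%N -> qRHP_up_to kappa q gam w n (Y n)) :
  exists c1 c2 c3 : nat -> Cx R,
    forall n, (0 < n)%N -> forall z, ~ trace gam z ->
      let C := mx2 (z + c1 n) (c2 n) (c3 n) 0 in
      Psi w (Y n.+1) z = C *m Psi w (Y n) z /\ Y n.+1 z = C *m Y n z.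
Proof.
have [a [b hrec]] : exists a b : nat -> Cx R,
    forall k, P k.+2 = ('X + (a k)%:P) * P k.+1 + b k *: P k.
  have /choice[a /choice[b hab]] := three_term_recurrence hP.
  by exists a, b.
have gam0 : forall n, gamma n != 0 by case: hP.
(* The recurrence for P_(n+1) is the one indexed by k = n - 1, which is why n >= 1 enters;
   [gamma n.-1] compensates the scaling of the second row of Y_n. *)
exists (fun n => a n.-1), (fun n => b n.-1 * gamma n.-1), (fun n => (gamma n)^-1).
case=> // k _ z hz C.
(* The diagonal factor of [Psi] acts on the right, so it commutes with left multiplication by
   [C]. *)
suff YC : Y k.+2 z = C *m Y k.+1 z by rewrite /Psi YC mulmxA.
have defect := @first_row_defect_constant R q gam w P gamma Y a b k gam0 hrec hY.
have defect0 := constant_defect_eq0 hq hgam hkappa (hRHP k.+1 isT) (hRHP k.+2 isT) defect.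
have [I1 [I2 [I1P I2P YE]]] := hY k.+1 isT z hz.
have [J1 [J2 [J1P J2P YE']]] := hY k.+2 isT z hz.
have := defect0 z hz; rewrite YE YE' !mxE /= => D0.
rewrite mulmx_mx2; congr mx2.
- by rewrite hrec !hornerE /=; field.
- by apply/eqP; rewrite -subr_eq0 -D0; apply/eqP; ring.
- by rewrite mul0r addr0.
(* The second-row integrand of Y_(n+1) is that of the first row of Y_n divided by gamma_n. *)
- rewrite mul0r addr0; apply: contour_integral_unique J2P _.
  have := contour_integralZ (gamma k.+1)^-1 I1P.
  by apply: eq_contour_integral => s _; rewrite mulrC.
Qed.
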